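(* If $w\in S_n$ is $1432$-avoiding, then the Grothendieck polynomial $\mathfrak G_w=\mathfrak G_w(x_1,\dots,x_n)$ has degree $$\deg(\mathfrak G_w)=\#D(w)+\sum_{k=1}^n\rho_d(\sigma_k(w)).$$
   Context: Permutations are written in one-line notation, $w_i=w(i)$. $w\in S_n$ is $1432$-avoiding if there are no indices $h<i<j<k$ with $w_h<w_k<w_j<w_i$. Grothendieck polynomials: $S_n$ acts on $\mathbb Z[x_1,\dots,x_n]$ by permuting variables; $s_i=(i\ i+1)$; $\partial_i f=\frac{f-s_if}{x_i-x_{i+1}}$ and $\pi_i f=\partial_i\big((1-x_{i+1})f\big)$. Set $\mathfrak G_{w_0}=x_1^{n-1}x_2^{n-2}\cdots x_{n-1}$ for the longest permutation $w_0=n\,(n-1)\cdots 1$, and $\mathfrak G_{ws_i}=\pi_i(\mathfrak G_w)$ whenever $w_i>w_{i+1}$; this is well defined. $\deg$ is the total degree (largest degree of a monomial with nonzero coefficient). Rothe diagram: $D(w)=\{(i,j)\in[n]\times[n] : w_i>j \text{ and } w^{-1}(j)>i\}$ (row $i$, column $j$). $\sigma_k(w)=\{(i,j)\in D(w): i>k \text{ and } j>w_k\}$. A diagonal path is a set $\{(i_1,j_1),\dots,(i_m,j_m)\}$ with $i_1<\cdots<i_m$ and $j_1<\cdots<j_m$ (not necessarily adjacent cells). $\rho_d(A)$ is the size of the largest diagonal path contained in $A\subseteq[n]\times[n]$ (so $\rho_d(\emptyset)=0$). *)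

(* Defs.v *)
From mathcomp Require Import all_boot all_order all_fingroup all_algebra.
From mathcomp Require Import mpoly.

Set Implicit Arguments.
Unset Strict Implicit.
Unset Printing Implicit Defensive.

Import GRing.Theory.
Local Open Scope ring_scope.

(* Indices are 0-based: rows, columns, positions and values all range over
   'I_n, and every comparison below is invariant under this shift. *)

Definition avoids1432 n (w : 'S_n) : Prop :=
  ~ exists h i j k : 'I_n,
      [/\ (h < i)%N, (i < j)%N & (j < k)%N] /\
      [/\ (w h < w k)%N, (w k < w j)%N & (w j < w i)%N].

Section DividedDifference.
Variable n : nat.
Implicit Types (i j : 'I_n) (f g : {mpoly int[n]}).

Lemma divdiff_subproof i j f :
  exists g, ('X_i - 'X_j) * g == f - msym (tperm i j) f.
Proof.
pose P f := exists g, ('X_i - 'X_j) * g = f - msym (tperm i j) f.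
suff [g Hg] : P f by exists g; apply/eqP.
have PM f1 f2 : P f1 -> P f2 -> P (f1 * f2).
  move=> [g1 H1] [g2 H2]; exists (g1 * f2 + msym (tperm i j) f1 * g2).
  by rewrite mulrDr mulrA H1 mulrCA H2 msymM mulrBl mulrBr addrA subrK.
have P1 : P 1 by exists 0; rewrite mulr0 msym1 subrr.
have PX k : P 'X_k.
  rewrite /P /msym mmapX mmap1U.
  case: tpermP => [->|->|_ _]; first by exists 1; rewrite mulr1.
    by exists (- 1); rewrite mulrN1 opprB.
  by exists 0; rewrite mulr0 subrr.
elim/mpolyind: f => [|c m f _ _ [g Hg]]; first by exists 0; rewrite mulr0 msym0 subrr.
have [h Hh] : P 'X_[m].
  rewrite mpolyXE_id; apply: (big_ind P) => // k _.
  by elim: (m k) => [|e IH]; rewrite ?expr0 // exprS; apply: PM.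
exists (c *: h + g).
by rewrite mulrDr -scalerAr Hh Hg msymD msymZ scalerBr opprD addrACA.
Qed.

(* For i != j the quotient is unique, {mpoly int[n]} being a domain. *)
Definition divdiff i j f : {mpoly int[n]} := xchoose (divdiff_subproof i j f).

Lemma divdiffE i j f :
  ('X_i - 'X_j) * divdiff i j f = f - msym (tperm i j) f.
Proof. exact/eqP/(xchooseP (divdiff_subproof i j f)). Qed.

Definition isobaric i j f : {mpoly int[n]} := divdiff i j ((1 - 'X_j) * f).

End DividedDifference.

Definition longest n : 'S_n := perm (@rev_ord_inj n).

(* [grothendieck w G] : G is obtained from the staircase monomial of the longest
   permutation along some chain of simple transpositions ending at w.  As these
   chains all give the same G, the relation determines the Grothendieck
   polynomial of w; it is total by [grothendieck_total].
   Since (s * t) x = t (s x) in 'S_n, the permutation w s_i, which swaps the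
   values at positions i and i + 1, is [tperm i j * w] with j = i + 1. *)
Inductive grothendieck n : 'S_n -> {mpoly int[n]} -> Prop :=
| Groth_longest :
    grothendieck (longest n) (\prod_(i < n) 'X_i ^+ (n - i.+1))
| Groth_step (w : 'S_n) (i j : 'I_n) (G : {mpoly int[n]}) :
    j = i.+1 :> nat -> (w j < w i)%N -> grothendieck w G ->
    grothendieck (tperm i j * w)%g (isobaric i j G).

Lemma decreasing_longest n (w : 'S_n) :
  (forall i j : 'I_n, j = i.+1 :> nat -> (w j < w i)%N) -> w = longest n.
Proof.
move=> dec.
have up (k : nat) (i : 'I_n) : i = k :> nat -> (w i + k < n)%N.
  elim: k i => [|k IH] i ik; first by rewrite addn0.
  have lt_kn : (k < n)%N by rewrite ltnW // -ik.
  have /= := IH (Ordinal lt_kn) erefl.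
  by apply: leq_ltn_trans; rewrite addnS -addSn leq_add2r; apply: dec.
have down (k : nat) (i : 'I_n) : (i + k.+1 = n)%N -> (k <= w i)%N.
  elim: k i => [|k IH] i ik //.
  have lt_in : (i.+1 < n)%N.
    have : (i.+1 < i + k.+2)%N by rewrite !addnS !ltnS leq_addr.
    by rewrite ik.
  apply: leq_ltn_trans (dec i (Ordinal lt_in) erefl).
  by apply: IH; rewrite /= addSnnS.
apply/permP=> i; apply/val_inj; rewrite permE /=; apply/eqP; rewrite eqn_leq.
apply/andP; split; last by apply: down; rewrite -subSn // subSS subnKC // ltnW.
by rewrite leq_subRL // addSn addnC up.
Qed.

Lemma grothendieck_total n (w : 'S_n) : exists G, grothendieck w G.
Proof.
pose wt (w : 'S_n) := (\sum_(k < n) k * w k)%N.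
have [m] := ubnP (wt w); elim: m w => // m IH w; rewrite ltnS => le_m.
case: (boolP [exists i : 'I_n, [exists j : 'I_n,
              (j == i.+1 :> nat) && (w i < w j)%N]]); last first.
  move=> noasc; exists (\prod_(i < n) 'X_i ^+ (n - i.+1)).
  rewrite (@decreasing_longest n w); first exact: Groth_longest.
  move=> i j ij; rewrite ltnNge leq_eqVlt; apply: contra noasc => /orP[|lt_w].
    move=> /eqP/val_inj/perm_inj eq_ij.
    by move: ij; rewrite eq_ij => /eqP; rewrite -[X in X == _]addn0 -addn1 eqn_add2l.
  by apply/existsP; exists i; apply/existsP; exists j; rewrite ij eqxx.
case/existsP=> i /existsP[j /andP[/eqP ij lt_w]].
have ne_ij : j != i by rewrite -val_eqE /= ij neq_ltn ltnSn orbT.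
pose w' := (tperm i j * w)%g.
have w'i : w' i = w j by rewrite permM tpermL.
have w'j : w' j = w i by rewrite permM tpermR.
have [|G HG] := IH w'.
  have wtE u : wt u = (i * u i + j * u j + \sum_(k < n | (k != i) && (k != j)) k * u k)%N.
    by rewrite /wt (bigD1 i) //= (bigD1 j) //= addnA.
  apply: leq_trans le_m; rewrite !wtE w'i w'j.
  rewrite [in X in (X < _)%N](eq_bigr (fun k : 'I_n => k * w k)%N); last first.
    by move=> k /andP[ki kj]; rewrite permM tpermD // eq_sym.
  rewrite ltn_add2r ij !mulSn [X in (X < _)%N]addnCA [X in (_ < X)%N]addnCA.
  by rewrite [(i * w j + _)%N]addnC ltn_add2r.
exists (isobaric i j G).
have -> : w = (tperm i j * w')%g by rewrite mulgA tperm2 mul1g.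
by apply: Groth_step => //; rewrite w'i w'j.
Qed.

(* msize is 1 + the total degree; degree 0 is assigned to the zero polynomial. *)
Definition mpdeg n (f : {mpoly int[n]}) : nat := (msize f).-1.

Section Diagrams.
Variable n : nat.
Local Notation cell := ('I_n * 'I_n)%type.

Definition rothe (w : 'S_n) : {set cell} :=
  [set c : cell | (c.2 < w c.1)%N && (c.1 < (w^-1)%g c.2)%N].

Definition sigma (w : 'S_n) (k : 'I_n) : {set cell} :=
  [set c : cell in rothe w | (k < c.1)%N && (w k < c.2)%N].

Definition cell_lt : rel cell := [rel a b : cell | (a.1 < b.1)%N && (a.2 < b.2)%N].

Definition diagonal_path (P : {set cell}) : bool :=
  [exists t : #|P|.-tuple cell, sorted cell_lt t && (P == [set:: t])].

Definition rho_d (A : {set cell}) : nat :=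
  \max_(P : {set cell} | (P \subset A) && diagonal_path P) #|P|.

End Diagrams.

(* Main.v *)
(* The idea is to compute the degree of every Grothendieck polynomial:
   deg G_w = sum_p (n - p - LIS_p), where LIS_p is the largest size of an
   increasing subsequence of w starting at position p (0-based).

   By Fomin and Kirillov, G_w is the coefficient of e_w in a product of factors
   1 + x_r e_(c + r) in the 0-Hecke algebra, indexed by the cells (r, c) of the
   staircase.  Multiplying by the factors one column at a time, let Lambda_j be
   the largest size of an increasing subsequence of w within the positions >= j.
   While column c is swept and the next letter is e_j, the degree of the
   coefficient of e_w is at most K - sum_(p >= c) LIS_p + Lambda_j with K
   growing by 1 at each letter, and this bound is attained whenever a longest
   increasing subsequence within the positions >= j starts at j and the value c
   sits at a position <= j.  At the end of the column Lambda_j is 1, which gives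
   both bounds on the degree; there is no cancellation because the coefficient
   of e_w has the sign (-1)^(deg - length w) in each degree.

   If w avoids 1432, the entries that follow w_p and exceed it avoid 321.  For a
   321-avoiding sequence, the number of entries minus the length of a longest
   increasing subsequence is the largest size of a diagonal path of inversions,
   a form of Koenig's theorem proved by matching the first top of an inversion
   with the first bottom. *)

Require Import Defs.
From mathcomp Require Import all_boot all_order all_fingroup all_algebra.
From mathcomp Require Import mpoly ring zify.

Set Implicit Arguments.
Unset Strict Implicit.
Unset Printing Implicit Defensive.

Import GRing.Theory Num.Theory.
Local Open Scope ring_scope.

(** * The Fomin-Kirillov product *)

Section ZeroHecke.
Variable m : nat.
Implicit Types (u w : 'S_m.+1) (j k : nat).

(** Positions are indexed by natural numbers so that [j.+1] needs no proof; an index above [m] falls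
    back to position 0, hence the bounds assumed below. *)
Definition pos k : 'I_m.+1 := inord k.

Lemma val_pos k : (k <= m)%N -> pos k = k :> nat.
Proof. by move=> km; rewrite inordK. Qed.

Lemma pos_eq k l : (k <= m)%N -> (l <= m)%N -> (pos k == pos l) = (k == l).
Proof. by move=> km lm; rewrite -val_eqE /= !val_pos. Qed.

Definition adj j : 'S_m.+1 := tperm (pos j) (pos j.+1).

Definition desc w j : bool := (w (pos j.+1) < w (pos j))%N.

Lemma adjK j w : (adj j * (adj j * w) = w)%g.
Proof. by rewrite mulgA tperm2 mul1g. Qed.

Lemma adj_comm j k w : (k < m)%N -> (j.+1 < k)%N ->
  (adj k * (adj j * w) = adj j * (adj k * w))%g.
Proof.
move=> km jk; rewrite !mulgA; congr (_ * _)%g.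
have ne a b : (a <= m)%N -> (b <= m)%N -> a <> b -> pos a != pos b.
  by move=> am bm /eqP; rewrite pos_eq.
have n02 : pos j != pos k by apply: ne; lia.
have n03 : pos j != pos k.+1 by apply: ne; lia.
have n12 : pos j.+1 != pos k by apply: ne; lia.
have n13 : pos j.+1 != pos k.+1 by apply: ne; lia.
apply/permP=> x; rewrite !permM /adj.
have [->|N0] := eqVneq x (pos j).
  by rewrite tpermL (@tpermD _ _ _ (pos j)) 1?eq_sym // tpermL tpermD // eq_sym.
have [->|N1] := eqVneq x (pos j.+1).
  by rewrite tpermR (@tpermD _ _ _ (pos j.+1)) 1?eq_sym // tpermR tpermD // eq_sym.
rewrite (@tpermD _ (pos j) _ x) 1?eq_sym //.
by case: (tpermP (pos k) _ x) => [_|_|_ _]; rewrite tpermD // eq_sym.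
Qed.

Lemma adj_braid j w : (j.+1 < m)%N ->
  (adj j.+1 * (adj j * (adj j.+1 * w)) = adj j * (adj j.+1 * (adj j * w)))%g.
Proof.
move=> jm; rewrite !mulgA; congr (_ * _)%g.
have n01 : pos j != pos j.+1 by rewrite pos_eq; lia.
have n12 : pos j.+1 != pos j.+2 by rewrite pos_eq; lia.
have n02 : pos j != pos j.+2 by rewrite pos_eq; lia.
have E := (tpermL (pos j) (pos j.+1), tpermR (pos j) (pos j.+1),
  tpermL (pos j.+1) (pos j.+2), tpermR (pos j.+1) (pos j.+2)).
have Ea : tperm (pos j) (pos j.+1) (pos j.+2) = pos j.+2 by rewrite tpermD.
have Eb : tperm (pos j.+1) (pos j.+2) (pos j) = pos j by rewrite tpermD // eq_sym.
apply/permP=> x; rewrite !permM /adj.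
have [->|N0] := eqVneq x (pos j); first by rewrite !(E, Ea, Eb).
have [->|N1] := eqVneq x (pos j.+1); first by rewrite !(E, Ea, Eb).
have [->|N2] := eqVneq x (pos j.+2); first by rewrite !(E, Ea, Eb).
by rewrite !tpermD // eq_sym.
Qed.

Section Action.
Variable R : comNzRingType.
Implicit Types (v : 'S_m.+1 -> R) (x y z : R).

(* Right multiplication of [\sum_w v w e_w] by [1 + x e_j] in the 0-Hecke
   algebra with [e_j ^ 2 = - e_j]. *)
Definition hecke j x v w : R :=
  v w + x * (desc w j)%:R * (v (adj j * w)%g - v w).

Lemma hecke_ext j x v1 v2 : v1 =1 v2 -> hecke j x v1 =1 hecke j x v2.
Proof. by move=> eqv w; rewrite /hecke !eqv. Qed.

Lemma heckeZ j x c v w : hecke j x (fun u => c * v u) w = c * hecke j x v w.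
Proof. by rewrite /hecke; ring. Qed.

Lemma adj_posL j w : (adj j * w)%g (pos j) = w (pos j.+1).
Proof. by rewrite permM tpermL. Qed.

Lemma adj_posR j w : (adj j * w)%g (pos j.+1) = w (pos j).
Proof. by rewrite permM tpermR. Qed.

Lemma adj_posD j k w : (j < m)%N -> (k <= m)%N -> k != j -> k != j.+1 ->
  (adj j * w)%g (pos k) = w (pos k).
Proof. by move=> jm km kj kj1; rewrite permM tpermD // pos_eq //; lia. Qed.

Lemma desc_adj j w : (j < m)%N -> desc (adj j * w)%g j = ~~ desc w j.
Proof.
move=> jm; rewrite /desc adj_posL adj_posR; case: ltngtP => // /val_inj/perm_inj.
by move/eqP; rewrite pos_eq; lia.
Qed.

Lemma desc_adj_far j k w : (j < m)%N -> (k < m)%N -> (j.+1 < k)%N || (k.+1 < j)%N ->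
  desc (adj j * w)%g k = desc w k.
Proof. by move=> jm km far; rewrite /desc !adj_posD //; lia. Qed.

Lemma hecke_comm j k x y v w : (j < m)%N -> (k < m)%N ->
    (j.+1 < k)%N || (k.+1 < j)%N ->
  hecke j x (hecke k y v) w = hecke k y (hecke j x v) w.
Proof.
move=> jm km far; rewrite /hecke (@desc_adj_far j k) // (@desc_adj_far k j) 1?orbC //.
have -> : (adj k * (adj j * w) = adj j * (adj k * w))%g.
  by case/orP: far => h; [apply: adj_comm | rewrite -adj_comm].
ring.
Qed.

Lemma hecke_comm1 j x y v w : (j < m)%N ->
  hecke j x (hecke j y v) w = hecke j y (hecke j x v) w.
Proof.
move=> jm; rewrite /hecke desc_adj // adjK.
by case: (desc w j) => /=; ring.
Qed.

(* [hecke j y] is inverted, up to the factor [1 - y], by [1 - y - y e_j]. *)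
Definition cohecke j y v w : R :=
  (1 - y) * v w - y * (desc w j)%:R * (v (adj j * w)%g - v w).

Lemma cohecke_hecke j y v w : (j < m)%N ->
  cohecke j y (hecke j y v) w = (1 - y) * v w.
Proof.
move=> jm; rewrite /cohecke /hecke desc_adj // adjK.
by case: (desc w j) => /=; ring.
Qed.

(** With [h_j(x) = 1 + x e_j], the left side is [(1 - x) * (1 - y)] times right multiplication by
    [h_(j+1)(y)^-1 h_j(x) h_(j+1)(y) h_j(y)], a product symmetric in [x] and [y]. Each relative
    order of the three values involved gives a ring identity. *)
Lemma yang_baxter j x y v w : (j.+1 < m)%N ->
  (1 - x) * hecke j y (hecke j.+1 y (hecke j x (cohecke j.+1 y v))) w =
  (1 - y) * hecke j x (hecke j.+1 x (hecke j y (cohecke j.+1 x v))) w.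
Proof.
move=> jm; have jm' : (j < m)%N by lia.
have aL := adj_posL j; have aR := adj_posR j.
have bL := adj_posL j.+1; have bR := adj_posR j.+1.
have aD u : (adj j * u)%g (pos j.+2) = u (pos j.+2) by rewrite adj_posD //; lia.
have bD u : (adj j.+1 * u)%g (pos j) = u (pos j) by rewrite adj_posD //; lia.
rewrite /hecke /cohecke /desc !(aL, aR, bL, bR, aD, bD).
have bab u := adj_braid u jm.
rewrite !(adjK, bab).
have n01 : w (pos j) <> w (pos j.+1) :> nat.
  by move/val_inj/perm_inj/eqP; rewrite pos_eq; lia.
have n02 : w (pos j) <> w (pos j.+2) :> nat.
  by move/val_inj/perm_inj/eqP; rewrite pos_eq; lia.
have n12 : w (pos j.+1) <> w (pos j.+2) :> nat.
  by move/val_inj/perm_inj/eqP; rewrite pos_eq; lia.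
case: (ltngtP (w (pos j)) (w (pos j.+1))) => h01;
case: (ltngtP (w (pos j.+1)) (w (pos j.+2))) => h12;
case: (ltngtP (w (pos j)) (w (pos j.+2))) => h02; try (exfalso; lia);
by rewrite /=; ring.
Qed.

Fixpoint sweep c (x : nat -> R) v r : 'S_m.+1 -> R :=
  if r is r'.+1 then hecke (c + r') (x r') (sweep c x v r') else v.

Lemma sweep_ext c (x1 x2 : nat -> R) v1 v2 r : x1 =1 x2 -> v1 =1 v2 ->
  sweep c x1 v1 r =1 sweep c x2 v2 r.
Proof.
by move=> eqx eqv; elim: r => //= r IH w; rewrite eqx; apply: hecke_ext.
Qed.

(* The Fomin-Kirillov product, column by column: the cell in row [r] and column
   [c] of the staircase contributes the factor [1 + x r e_(c + r)]. *)
Fixpoint kirillov (x : nat -> R) d : 'S_m.+1 -> R :=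
  if d is d'.+1 then sweep (m - d'.+1) x (kirillov x d') d'.+1
  else fun w => (w == 1%g)%:R.

Lemma kirillov_ext (x1 x2 : nat -> R) d : x1 =1 x2 -> kirillov x1 d =1 kirillov x2 d.
Proof. by move=> eqx; elim: d => // d IH; apply: sweep_ext. Qed.

End Action.

Section Morphism.
Variables (R R' : comNzRingType) (phi : {rmorphism R -> R'}).

Lemma rmorph_hecke j x v w :
  phi (hecke j x v w) = hecke j (phi x) (phi \o v) w.
Proof. by rewrite /hecke rmorphD !rmorphM rmorphB rmorph_nat. Qed.

Lemma rmorph_cohecke j x v w :
  phi (cohecke j x v w) = cohecke j (phi x) (phi \o v) w.
Proof. by rewrite /cohecke rmorphB !rmorphM !rmorphB rmorph_nat rmorph1. Qed.

Lemma rmorph_sweep c x v r w :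
  phi (sweep c x v r w) = sweep c (phi \o x) (phi \o v) r w.
Proof.
elim: r w => //= r IH w.
by rewrite rmorph_hecke; apply: hecke_ext => u; apply: IH.
Qed.

Lemma rmorph_kirillov x d w : phi (kirillov x d w) = kirillov (phi \o x) d w.
Proof.
elim: d w => [|d IH] w; first by rewrite /= rmorph_nat.
by rewrite rmorph_sweep; apply: sweep_ext.
Qed.

End Morphism.

(** * Symmetry of the product in two adjacent variables *)

Section Symmetry.
Variables (R : idomainType) (phi : {rmorphism R -> R}) (x : nat -> R) (i : nat).
Hypotheses (phi_l : phi (x i) = x i.+1) (phi_r : phi (x i.+1) = x i).
Hypothesis phi_D : forall r, (r <= m)%N -> r != i -> r != i.+1 -> phi (x r) = x r.
Hypotheses (reg_l : 1 - x i != 0) (reg_r : 1 - x i.+1 != 0).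
Implicit Types (v : 'S_m.+1 -> R).

Definition fixed v := forall w, phi (v w) = v w.

Lemma fixed_ext v1 v2 : v1 =1 v2 -> fixed v1 -> fixed v2.
Proof. by move=> eqv sv w; rewrite -eqv sv. Qed.

Lemma fixed_hecke j z v : phi z = z -> fixed v -> fixed (hecke j z v).
Proof. by move=> zf vf w; rewrite rmorph_hecke zf; apply: hecke_ext. Qed.

Lemma fixed_hecke2 j v : (j < m)%N -> fixed v ->
  fixed (hecke j (x i.+1) (hecke j (x i) v)).
Proof.
move=> jm vf w; rewrite rmorph_hecke phi_r hecke_comm1 //.
apply: hecke_ext => u; rewrite /= rmorph_hecke phi_l; exact: hecke_ext.
Qed.

(** Up to a nonzero factor [v] is recovered from the fixed [S] by [cohecke], and [phi] then
    exchanges the two sides of [yang_baxter]. *)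
Lemma fixed_hecke3 j v : (j.+1 < m)%N -> fixed (hecke j.+1 (x i.+1) v) ->
  fixed (hecke j (x i.+1) (hecke j.+1 (x i.+1) (hecke j (x i) v))).
Proof.
move=> jm; set x0 := x i; set y := x i.+1; set S := hecke j.+1 y v => Sf w.
pose Q a b := hecke j b (hecke j.+1 b (hecke j a (cohecke j.+1 b S))).
set T := hecke j y _.
have TQ : (1 - y) * T w = Q x0 y w.
  rewrite -heckeZ /T /Q; apply: hecke_ext => u.
  rewrite -heckeZ; apply: hecke_ext => {}u; rewrite -heckeZ.
  by apply: hecke_ext => {}u; rewrite cohecke_hecke.
have phiQ : phi (Q x0 y w) = Q y x0 w.
  rewrite /Q rmorph_hecke phi_r; apply: hecke_ext => u /=.
  rewrite rmorph_hecke phi_r; apply: hecke_ext => {}u /=.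
  rewrite rmorph_hecke phi_l; apply: hecke_ext => {}u /=.
  by rewrite rmorph_cohecke phi_r /cohecke /= !Sf.
apply: (mulfI reg_l); apply: (mulfI reg_r).
have -> : (1 - y) * ((1 - x0) * T w) = (1 - x0) * ((1 - y) * T w) by ring.
rewrite TQ yang_baxter // -/(Q y x0 w) -phiQ -TQ rmorphM rmorphB rmorph1 phi_r.
by [].
Qed.

(** Row [i] has one cell more than row [i.+1], so symmetry needs an extra factor in [x i.+1]. Its
    letter is that of row [i.+1] in the next column, which is the configuration of
    [fixed_hecke3]. *)
Lemma fixed_kirillov d : (d <= m)%N ->
  if (i < d)%N then fixed (hecke (m - d + i) (x i.+1) (kirillov x d))
  else fixed (kirillov x d).
Proof.
elim: d => [|d IH] dm /=; first by move=> w /=; rewrite rmorph_nat.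
have {}IH := IH (ltnW dm).
rewrite -/(sweep (m - d.+1) x (kirillov x d) d.+1).
have mc : (m - d = (m - d.+1).+1)%N by lia.
rewrite {}mc in IH; set c := (m - d.+1)%N in IH *.
have cm : (c + d.+1 = m)%N by rewrite /c; lia.
set v := kirillov x d in IH *; set S := sweep c x v.
case: ltngtP IH => [id|di|id] IH.
- rewrite ltnS ltnW //.
  (* The letters of the rows before [i] commute with the extra letter [c.+1 + i]. *)
  have lo r : (r <= i)%N -> fixed (hecke (c.+1 + i) (x i.+1) (S r)).
    elim: r => [|r IHr] ri //=.
    apply: (@fixed_ext (hecke (c + r) (x r) (hecke (c.+1 + i) (x i.+1) (S r)))).
      by move=> u; rewrite hecke_comm //; lia.
    by apply: fixed_hecke; [apply: phi_D; lia | apply: IHr; lia].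
  have mid : fixed (hecke (c + i) (x i.+1) (S i.+2)).
    by rewrite /S /= addnS; apply: fixed_hecke3; [lia | apply: lo].
  have hi k : (i.+2 + k <= d.+1)%N -> fixed (hecke (c + i) (x i.+1) (S (i.+2 + k)%N)).
    elim: k => [|k IHk] kd; first by rewrite addn0.
    rewrite addnS.
    apply: (@fixed_ext (hecke (c + (i.+2 + k)) (x (i.+2 + k)%N)
                          (hecke (c + i) (x i.+1) (S (i.+2 + k)%N)))).
      by move=> u; rewrite hecke_comm //; lia.
    by apply: fixed_hecke; [apply: phi_D; lia | apply: IHk; lia].
  by have := hi (d.+1 - i.+2)%N; rewrite subnKC; [apply; lia | lia].
- rewrite ltnS leqNgt di /=.
  suff: forall r, (r <= d.+1)%N -> fixed (S r) by apply.
  elim=> [|r IHr] ri //=.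
  by apply: fixed_hecke; [apply: phi_D; lia | apply: IHr; lia].
(* This is the first column that reaches row [i]: its last factor and the extra one have the same
   letter. *)
rewrite id ltnS leqnn.
have lo r : (r <= d)%N -> fixed (S r).
  elim: r => [|r IHr] ri //=.
  by apply: fixed_hecke; [apply: phi_D; lia | apply: IHr; lia].
by rewrite /S /= -id; apply: fixed_hecke2; [lia | apply: lo; lia].
Qed.

(* If [hecke j y v] is fixed then so are [v (adj j * w)] and
   [(1 - y) * v w + y * v (adj j * w)], when [j] is a descent of [w]. *)
Lemma kirillov_step w : (i < m)%N -> desc w i ->
  (x i - x i.+1) * kirillov x m (adj i * w)%g =
  (1 - x i.+1) * kirillov x m w - phi ((1 - x i.+1) * kirillov x m w).
Proof.
move=> im dw; have := fixed_kirillov (leqnn m); rewrite im subnn add0n => sym.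
have := sym (adj i * w)%g; rewrite {1 2}/hecke desc_adj // dw /= mulr0 mul0r addr0.
move=> sym1; have := sym w; rewrite /hecke dw mulr1.
set a := kirillov x m w; set b := kirillov x m _ in sym1 *.
have -> : a + x i.+1 * (b - a) = (1 - x i.+1) * a + x i.+1 * b by ring.
rewrite rmorphD [phi (_ * b)]rmorphM sym1 phi_r => /(canRL (addrK _)) ->.
ring.
Qed.

End Symmetry.
End ZeroHecke.

(** * Increasing subsequences under a simple transposition *)

Section IncreasingSubsets.
Variable n : nat.
Implicit Types (w : 'S_n) (p q : 'I_n) (I J A : {set 'I_n}).

Definition inc w I : bool :=
  [forall p in I, forall q in I, (p < q)%N ==> (w p < w q)%N].

Lemma incP w I :
  reflect (forall p q, p \in I -> q \in I -> (p < q)%N -> (w p < w q)%N) (inc w I).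
Proof.
apply: (iffP forall_inP) => [H p q pI qI pq|H p pI].
  by have /forall_inP/(_ q qI)/implyP := H p pI; apply.
by apply/forall_inP=> q qI; apply/implyP; apply: H.
Qed.

Lemma incS w I J : J \subset I -> inc w I -> inc w J.
Proof.
move=> /subsetP JI /incP H; apply/incP => p q /JI pI /JI qI; exact: H.
Qed.

Definition lis w A : nat := \max_(I : {set 'I_n} | (I \subset A) && inc w I) #|I|.

Lemma lis_ge w A I : I \subset A -> inc w I -> (#|I| <= lis w A)%N.
Proof. by move=> IA Iw; rewrite /lis (bigD1 I) ?IA ?Iw //= leq_maxl. Qed.

Lemma lis_ex w A : exists I, [/\ I \subset A, inc w I & #|I| = lis w A].
Proof.
rewrite /lis; case: (@eq_bigmax_cond _ [pred I : {set 'I_n} | (I \subset A) && inc w I]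
  (fun I => #|I|)) => [|I /andP[IA Iw] ->]; last by exists I.
apply/card_gt0P; exists set0; rewrite inE sub0set /=.
by apply/incP => p q; rewrite inE.
Qed.

Definition above w p : {set 'I_n} := [set q : 'I_n | (p < q)%N && (w p < w q)%N].

(** This is the number LIS_p; the successor counts [p] itself. *)
Definition lis_from w p : nat := (lis w (above w p)).+1.

Lemma lis_from_ge w p I : inc w I -> p \in I -> (forall q, q \in I -> (p <= q)%N) ->
  (#|I| <= lis_from w p)%N.
Proof.
move=> Iw pI pmin; rewrite (cardsD1 p) pI add1n ltnS; apply: lis_ge.
  apply/subsetP => q; rewrite !inE => /andP[qp qI].
  have pq : (p < q)%N by rewrite ltn_neqAle pmin // andbT eq_sym.
  by rewrite pq (incP _ _ Iw).
exact: incS (subsetDl _ _) Iw.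
Qed.

Lemma lis_from_ex w p : exists I,
  [/\ inc w I, p \in I, forall q, q \in I -> (p <= q)%N & #|I| = lis_from w p].
Proof.
have [I [/subsetP IA Iw cI]] := lis_ex w (above w p).
have IA1 q : q \in I -> (p < q)%N by move/IA; rewrite inE => /andP[].
have IA2 q : q \in I -> (w p < w q)%N by move/IA; rewrite inE => /andP[].
exists (p |: I); split; last 1 first.
- by rewrite cardsU1 /lis_from -cI; case: (boolP (p \in I)) => // /IA1; rewrite ltnn.
- apply/incP => a b; rewrite !inE => /predU1P[->|aI] /predU1P[->|bI].
  + by rewrite ltnn.
  + by move=> _; apply: IA2.
  + by move/IA1: aI => /ltnW; rewrite leqNgt => /negPf->.
  + exact: (incP _ _ Iw).
- by rewrite !inE eqxx.
by move=> q; rewrite !inE => /predU1P[->//|/IA1/ltnW].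
Qed.

Definition tail k : {set 'I_n} := [set q : 'I_n | (k <= q)%N].

(** This is the number Lambda_k. *)
Definition lis_tail w k : nat := lis w (tail k).

Lemma lis_tail_ex w k : exists I,
  [/\ I \subset tail k, inc w I & #|I| = lis_tail w k].
Proof. exact: lis_ex. Qed.

Lemma lis_from_tail w p k : (k <= p)%N -> (lis_from w p <= lis_tail w k)%N.
Proof.
move=> kp; have [I [Iw _ Ip <-]] := lis_from_ex w p; apply: lis_ge => //.
by apply/subsetP=> q /Ip pq; rewrite inE (leq_trans kp).
Qed.

Definition score w k : nat := \sum_(p in tail k) lis_from w p.

End IncreasingSubsets.

Section Sweep.
Variable m : nat.
Implicit Types (w : 'S_m.+1) (p q : 'I_m.+1) (I : {set 'I_m.+1}).

Lemma tailD1 k q : (k <= m)%N -> (q \in tail m.+1 k) && (q != pos m k) = (q \in tail _ k.+1).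
Proof. by move=> km; rewrite !inE -val_eqE /= val_pos // ltn_neqAle eq_sym andbC. Qed.

Lemma score_pos w k : (k <= m)%N -> score w k = (lis_from w (pos m k) + score w k.+1)%N.
Proof.
move=> km; rewrite /score (bigD1 (pos m k)) ?inE ?val_pos //=; congr addn.
by apply: eq_bigl => q; rewrite tailD1.
Qed.

Lemma lis_tailS w k : (k <= m)%N -> (lis_tail w k <= (lis_tail w k.+1).+1)%N.
Proof.
move=> km; have [I [Ik Iw <-]] := lis_tail_ex w k.
rewrite (cardsD1 (pos m k)); suff: (#|I :\ pos m k| <= lis_tail w k.+1)%N.
  by case: (_ \in _) => //; apply: leqW.
apply: lis_ge; last exact: incS (subsetDl _ _) Iw.
apply/subsetP=> q; rewrite 2!inE andbC -tailD1 // => /andP[/(subsetP Ik) -> //].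
Qed.

Lemma lis_tail_last w : lis_tail w m = 1%N.
Proof.
apply/eqP; rewrite eqn_leq; apply/andP; split.
  have [I [Ik _ <-]] := lis_tail_ex w m.
  rewrite -(cards1 (pos m m)); apply/subset_leq_card/subsetP => q /(subsetP Ik).
  by rewrite !inE -val_eqE /= val_pos //; have := ltn_ord q; lia.
by apply: leq_trans (_ : (lis_from w (pos m m) <= _)%N); rewrite ?lis_from_tail ?val_pos.
Qed.

Variable j : nat.
Hypothesis jm : (j < m)%N.
Local Notation a := (pos m j).
Local Notation b := (pos m j.+1).
Local Notation s := (adj m j).

Lemma ab_val : a = j :> nat /\ b = j.+1 :> nat.
Proof. by rewrite !val_pos // ltnW. Qed.

Lemma adj_lt p q : (p < q)%N -> (s p < s q)%N \/ (p = a /\ q = b).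
Proof.
have [va vb] := ab_val => pq.
have [E|E] := boolP ((p == a) && (q == b)); first by right; case/andP: E => /eqP-> /eqP->.
left; move: E pq; rewrite -!val_eqE /= va vb /adj.
by case: (tpermP a b p) => [->|->|/eqP + /eqP +];
   case: (tpermP a b q) => [->|->|/eqP + /eqP +]; rewrite -?val_eqE /=; lia.
Qed.

Lemma adj_tail k p : (k <= j)%N -> (s p \in tail _ k) = (p \in tail _ k).
Proof.
have [va vb] := ab_val => kj; rewrite !inE /adj.
by case: tpermP => [->|->|//]; lia.
Qed.

Lemma adjJ w p : (s * w)%g (s p) = w p.
Proof. by rewrite permM /adj tpermK. Qed.

Lemma adjE w p : p != a -> p != b -> (s * w)%g p = w p.
Proof. by move=> pa pb; rewrite permM tpermD // eq_sym. Qed.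

Lemma score_adj w k : (k <= j)%N ->
  score (s * w)%g k = (\sum_(p in tail _ k) lis_from (s * w)%g (s p))%N.
Proof.
move=> kj; rewrite /score (reindex_inj (@perm_inj _ s)) /=.
by apply: eq_bigl => p; rewrite adj_tail.
Qed.

Variable w : 'S_m.+1.
Hypothesis dw : desc w j.
Local Notation u := (s * w)%g.

(** At a descent an increasing set contains at most one of [a] and [b], the only pair of positions
    whose order [s] reverses. *)
Lemma inc_adj I : inc w I -> inc u (s @: I).
Proof.
move=> Iw; apply/incP => _ _ /imsetP[p pI ->] /imsetP[q qI ->] pq.
rewrite !adjJ; case: (adj_lt pq); rewrite /adj ?tpermK; first exact: (incP _ _ Iw).
case=> pa qb; have [va vb] := ab_val.
have pb : p = b by rewrite -(tpermK a b p) pa tpermL.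
have qa : q = a by rewrite -(tpermK a b q) qb tpermR.
have := incP _ _ Iw q p qI pI; rewrite pb qa va vb ltnSn => /(_ isT).
by move: dw; rewrite /desc; lia.
Qed.

Lemma inc_adjV I : inc u I -> ~~ ((a \in I) && (b \in I)) -> inc w (s @: I).
Proof.
move=> Iu nab; apply/incP => _ _ /imsetP[p pI ->] /imsetP[q qI ->] pq.
have E x : w (s x) = u x by rewrite permM.
rewrite !E; case: (adj_lt pq); rewrite /adj ?tpermK; first exact: (incP _ _ Iu).
case=> pa qb; case/negP: nab.
have <- : p = b by rewrite -(tpermK a b p) pa tpermL.
have <- : q = a by rewrite -(tpermK a b q) qb tpermR.
by rewrite pI qI.
Qed.

(** Beyond [a], going from [u] to [w] only lowers the value at [b], the first position left. *)
Lemma inc_drop I : inc u I -> I \subset tail _ j.+1 -> inc w I.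
Proof.
have [va vb] := ab_val; move: dw; rewrite /desc => dw'.
move=> Iu /subsetP Ij; apply/incP => p q pI qI pq.
have := incP _ _ Iu p q pI qI pq.
have := Ij p pI; have := Ij q qI; rewrite !inE => jq jp.
have qb : q != b by rewrite -val_eqE /= vb; lia.
have qa : q != a by rewrite -val_eqE /= va; lia.
have pa : p != a by rewrite -val_eqE /= va; lia.
rewrite (adjE _ qa qb).
have [->|pb] := eqVneq p b; last by rewrite adjE.
by rewrite adj_posR; lia.
Qed.

(** If a longest set contains [a], it omits [b], and [b] can replace [a] because its value is
    smaller. *)
Lemma lis_tail_desc : (lis_tail w j <= lis_tail w j.+1)%N.
Proof.
have [va vb] := ab_val; move: dw; rewrite /desc => dw'.
have [I [Ij Iw <-]] := lis_tail_ex w j.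
have [aI|aI] := boolP (a \in I); last first.
  apply: lis_ge => //; apply/subsetP => q qI; rewrite -tailD1 ?(ltnW jm) //.
  by rewrite (subsetP Ij) //=; apply: contraNneq aI => <-.
have bI : b \notin I.
  by apply/negP => bI; have := incP _ _ Iw a b aI bI; rewrite va vb; lia.
have cI : #|b |: (I :\ a)| = #|I|.
  by rewrite cardsU1 (cardsD1 a I) aI !inE negb_and bI orbT.
rewrite -cI; apply: lis_ge.
  apply/subsetP => q; rewrite 4!inE => /predU1P[->|/andP[qa qI]]; first by rewrite inE vb.
  by rewrite -tailD1 ?(ltnW jm) // qa (subsetP Ij).
apply/incP => p q; rewrite !inE => /predU1P[->|/andP[pa pI]] /predU1P[->|/andP[qa qI]].
- by rewrite ltnn.
- move=> bq; have := incP _ _ Iw a q aI qI; rewrite va; move: bq; rewrite vb; lia.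
- have := subsetP Ij p pI; rewrite inE vb => jp pj; case/negP: pa.
  by rewrite -val_eqE /= va; lia.
exact: (incP _ _ Iw).
Qed.

Lemma lis_from_adj p : (lis_from w p <= lis_from u (s p))%N.
Proof.
have [va vb] := ab_val; have [I [Iw pI Ip <-]] := lis_from_ex w p.
rewrite -(card_imset I (@perm_inj _ s)); apply: lis_from_ge; first exact: inc_adj.
  exact: imset_f.
move=> _ /imsetP[q qI ->]; have := Ip q qI; rewrite leq_eqVlt => /orP[/eqP/val_inj->//|pq].
case: (adj_lt pq) => [/ltnW//|[pa qb]].
have := incP _ _ Iw p q pI qI pq; rewrite pa qb; move: dw; rewrite /desc; lia.
Qed.

(** A longest set either starts at [a], or lies beyond [a] and is then increasing for [w] as
    well. *)
Lemma lis_tail_adj :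
  (lis_tail u j <= lis_tail w j.+1)%N \/ (lis_tail u j <= lis_from u a)%N.
Proof.
have [va vb] := ab_val; have [I [Ij Iu <-]] := lis_tail_ex u j.
have [aI|aI] := boolP (a \in I); last first.
  left; suff Ij' : I \subset tail _ j.+1 by apply: lis_ge => //; apply: inc_drop.
  apply/subsetP => q qI; rewrite -tailD1 ?(ltnW jm) //.
  by rewrite (subsetP Ij) //=; apply: contraNneq aI => <-.
right; apply: lis_from_ge => // q /(subsetP Ij); by rewrite inE va.
Qed.

Lemma score_adj_le k : (k <= j)%N ->
  (score w k + lis_tail u j <= score u k + lis_tail w j.+1)%N.
Proof.
have [va vb] := ab_val => kj.
case: lis_tail_adj => h.
  apply: leq_add => //; rewrite score_adj //.
  by apply: leq_sum => p _; apply: lis_from_adj.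
(* Here the summand of [b] pays for the change: it is at most [lis_tail w j.+1] for [w] and becomes
   [lis_from u a], which is at least [lis_tail u j]. *)
have bk : b \in tail _ k by rewrite inE vb; lia.
have split F : (\sum_(p in tail m.+1 k) F p =
    F b + \sum_(p in tail m.+1 k | p != b) F p)%N by rewrite (bigD1 b).
have sb : s b = a by rewrite /adj tpermR.
rewrite score_adj // /score !split sb.
have h1 := @lis_from_tail _ w b j.+1; rewrite vb leqnn in h1.
suff : (\sum_(p in tail m.+1 k | p != b) lis_from w p <=
        \sum_(p in tail m.+1 k | p != b) lis_from u (s p))%N.
  by move: h h1 => /[swap] /(_ isT); lia.
by apply: leq_sum => p _; apply: lis_from_adj.
Qed.

Hypothesis peak : (lis_tail w j.+1 <= lis_from w b)%N.

Lemma lis_from_adj_top : (lis_from w b <= lis_from u a)%N.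
Proof. by have := lis_from_adj b; rewrite {2}/adj tpermR. Qed.

Lemma peak_adj : (lis_tail u j <= lis_from u a)%N.
Proof.
case: lis_tail_adj => // /leq_trans; apply.
exact: leq_trans peak lis_from_adj_top.
Qed.

Lemma lis_from_adjV p : (forall I, inc u I -> a \in I -> b \in I -> s p \in I ->
    (forall q, q \in I -> (s p <= q)%N) -> (#|I| <= lis_from w p)%N) ->
  (lis_from u (s p) <= lis_from w p)%N.
Proof.
move=> both; have [I [Iu pI Ip <-]] := lis_from_ex u (s p).
have [/andP[aI bI]|nab] := boolP ((a \in I) && (b \in I)); first exact: both.
rewrite -(card_imset I (@perm_inj _ s)); apply: lis_from_ge.
- exact: inc_adjV.
- by rewrite -[p](tpermK a b); apply: imset_f.
move=> _ /imsetP[q qI ->]; have := Ip q qI; rewrite leq_eqVlt => /orP[/eqP/val_inj <-|pq].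
  by rewrite /adj tpermK.
case: (adj_lt pq) => [|[pa qb]]; first by rewrite /adj tpermK => /ltnW.
by case/negP: nab; rewrite -{1}pa -qb pI.
Qed.

(** Each condition controls the increasing sets of [u] that contain both [a] and [b], the only ones
    that [s] need not carry back to [w]. *)
Lemma score_adj_ge k : (k <= j)%N ->
    (lis_from w a < lis_tail w j.+1)%N \/ (forall p, (k <= p)%N -> (w b <= w p)%N) ->
  (score u k + lis_tail w j.+1 <= score w k + lis_tail u j)%N.
Proof.
have [va vb] := ab_val => kj cond.
have top : (lis_tail w j.+1 <= lis_tail u j)%N.
  apply: leq_trans peak (leq_trans lis_from_adj_top _).
  by apply: lis_from_tail; rewrite va.
rewrite score_adj //; case: cond => [low|minb].
  apply: leq_add => //; apply: leq_sum => p _; apply: lis_from_adjV => I Iu aI bI pI Ip.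
  have [K [Kw bK Kb cK]] := lis_from_ex w b.
  have wb : w b = u a by rewrite adj_posL.
  have wa : w a = u b by rewrite adj_posR.
  (* [K] replaces [a], [b] and [H] in [I]. Since [a |: H] is increasing for [w], [#|H|.+1 <=
     lis_from w a < lis_tail w j.+1 <= #|K|]; the values on [L] lie below [u a = w b]. *)
  pose L := [set q in I | (q < j)%N]; pose H := [set q in I | (j.+1 < q)%N].
  have uE q : (q < j)%N || (j.+1 < q)%N -> u q = w q.
    by move=> jq; rewrite adjE // -val_eqE /= ?va ?vb; lia.
  have cI : (#|I| <= #|L| + (#|H|.+2))%N.
    have -> : (#|L| + #|H|.+2 = #|L| + (#|[set a; b]| + #|H|))%N.
      by rewrite cards2 -val_eqE /= va vb; lia.
    apply: leq_trans (leq_add (leqnn _) (leq_card_setU _ _)).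
    apply: leq_trans (leq_card_setU _ _).
    apply/subset_leq_card/subsetP=> q qI; rewrite !inE qI -!val_eqE /= va vb; lia.
  have cH : (#|H|.+1 <= lis_from w a)%N.
    have <- : #|a |: H| = #|H|.+1 by rewrite cardsU1 inE va ltnNge leqnSn andbF.
    apply: lis_from_ge; last 1 first.
    - by move=> q; rewrite !inE => /predU1P[->//|/andP[_]]; rewrite va; lia.
    - apply/incP => q r; rewrite !inE => /predU1P[->|/andP[qI qj]] /predU1P[->|/andP[rI rj]].
      + by rewrite ltnn.
      + move=> _; rewrite wa -(uE r) ?rj ?orbT //; apply: (incP _ _ Iu) => //.
        by rewrite vb.
      + by rewrite va; lia.
      + move=> qr; rewrite -(uE r) ?rj ?orbT // -(uE q) ?qj ?orbT //.
        exact: (incP _ _ Iu).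
    - by rewrite !inE eqxx.
  have LKw : inc w (L :|: K).
    apply/incP => q r; rewrite !inE => /orP[/andP[qI qj]|qK] /orP[/andP[rI rj]|rK] qr.
    - by rewrite -(uE r) ?rj // -(uE q) ?qj //; apply: (incP _ _ Iu).
    - rewrite -(uE q) ?qj //; apply: leq_trans (_ : w b <= w r)%N.
        by rewrite wb; apply: (incP _ _ Iu) => //; rewrite va.
      have := Kb r rK; rewrite leq_eqVlt => /orP[/eqP/val_inj->//|br].
      by rewrite ltnW // (incP _ _ Kw).
    - by have := Kb q qK; rewrite vb; lia.
    - exact: (incP _ _ Kw).
  have cLK : #|L :|: K| = (#|L| + #|K|)%N.
    rewrite cardsU disjoint_setI0 ?cards0 ?subn0 //.
    apply/pred0P => q /=; rewrite !inE; apply/negP => /andP[/andP[_ qj] /Kb].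
    by rewrite vb; lia.
  have leIK : (#|I| <= #|L :|: K|)%N by rewrite cLK; lia.
  apply: leq_trans leIK _; have := Ip a aI; rewrite va leq_eqVlt => /orP[/eqP spa|spj].
    have -> : p = b.
      by rewrite -(tpermK a b p) -/s (_ : s p = a) ?tpermL //; apply/val_inj; rewrite /= spa va.
    apply: lis_from_ge => //; first by rewrite !inE bK orbT.
    by move=> q; rewrite !inE => /orP[/andP[/Ip]|/Kb//]; rewrite spa; lia.
  have psp : s p = p.
    by move: spj; rewrite /adj; case: tpermP => [->|->|//]; rewrite ?va ?vb; lia.
  rewrite psp in pI spj Ip; apply: lis_from_ge => //; first by rewrite !inE pI spj.
  move=> q; rewrite !inE => /orP[/andP[/Ip//]|/Kb]; rewrite vb; lia.
have bk : b \in tail _ k by rewrite inE vb; lia.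
have split F : (\sum_(p in tail m.+1 k) F p =
    F b + \sum_(p in tail m.+1 k | p != b) F p)%N by rewrite (bigD1 b).
have sb : s b = a by rewrite /adj tpermR.
rewrite /score !split sb.
have h1 : (lis_from u a <= lis_tail u j)%N by apply: lis_from_tail; rewrite va.
suff: (\sum_(p in tail m.+1 k | p != b) lis_from u (s p) <=
       \sum_(p in tail m.+1 k | p != b) lis_from w p)%N.
  move: peak h1; lia.
(* A set with both [a] and [b] would start at some [p] before [a] with [w p < w b], against the
   minimality of [w b]. *)
apply: leq_sum => p /andP[pk pb]; apply: lis_from_adjV => I Iu aI bI pI Ip.
have pk' : (k <= p)%N by move: pk; rewrite inE.
have pa : p != a.
  apply: contraTneq dw => pa; have := Ip a aI.
  by rewrite pa /adj tpermL va vb ltnn.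
have psp : s p = p by rewrite /adj tpermD // eq_sym.
rewrite psp in pI Ip.
have := Ip a aI; rewrite leq_eqVlt => /orP[/eqP/val_inj/eqP|pa']; first by rewrite (negPf pa).
have := incP _ _ Iu p a pI aI pa'; rewrite adjE // adj_posL => /leq_trans/(_ (minb p pk')).
by rewrite ltnn.
Qed.

End Sweep.

(** * Degrees of the coefficients *)

Section Degree.
Variable m : nat.
Implicit Types (w u : 'S_m.+1) (p q : 'I_m.+1).

(** For [d = m] this is the sum of [n - p] over the positions [p], with [n = m.+1]. *)
Definition triangle d : nat := (\sum_(i < d.+1) i.+1)%N.

Lemma triangleS d : triangle d.+1 = (triangle d + d.+2)%N.
Proof. by rewrite /triangle big_ord_recr. Qed.

(** * Upper bound on the degrees *)

Section UpperBound.
Variable x : nat -> {mpoly int[m.+1]}.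
Hypothesis msize_x : forall r, (msize (x r) <= 2)%N.


Lemma msize_mulx r (f : {mpoly int[m.+1]}) : (msize (x r * f) <= (msize f).+1)%N.
Proof.
have [->|x0] := eqVneq (x r) 0; first by rewrite mul0r msize0.
have [->|f0] := eqVneq f 0; first by rewrite mulr0 msize0.
rewrite msizeM //; move: (msize_x r); move: (msize (x r)) (msize f) => a b; lia.
Qed.

Lemma msize_hecke j r v w k : desc w j -> (msize (v w) <= k)%N ->
  (msize (v (adj m j * w)%g) <= k)%N -> (msize (hecke j (x r) v w) <= k.+1)%N.
Proof.
move=> dw vk uk; rewrite /hecke dw mulr1.
apply: leq_trans (msizeD_le _ _) _; rewrite geq_max leqW //=.
apply: leq_trans (msize_mulx _ _) _; rewrite ltnS.
by apply: leq_trans (msizeD_le _ _) _; rewrite msizeN geq_max uk vk.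
Qed.

(** The bound [K - score + Lambda] with [K = t + r], the successor turning degree into [msize]. At
    an ascent Lambda drops by at most one while [r] grows; at a descent [lis_tail_desc] and
    [score_adj_le] bound the two terms of [hecke]. *)
Lemma msize_sweep c v t :
    (forall w, (msize (v w) + score w c.+1 <= t.+1)%N) ->
  forall r, (c + r <= m)%N -> forall w,
  (msize (sweep c x v r w) + score w c <= (t + r + lis_tail w (c + r)).+1)%N.
Proof.
move=> vt; elim=> [|r IH] cr w /=.
  rewrite !addn0; rewrite (@score_pos _ w c); last by lia.
  have := vt w.
  have := @lis_from_tail _ w (pos m c) c; rewrite val_pos; last by lia.
  by move=> /(_ (leqnn _)); lia.
rewrite addnS in cr *; have {}IH := IH (ltnW cr).
have cj : (c <= c + r)%N by rewrite leq_addr.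
have [dw|ndw] := boolP (desc w (c + r)); last first.
  have -> : hecke (c + r) (x r) (sweep c x v r) w = sweep c x v r w.
    by rewrite /hecke (negPf ndw) mulr0 mul0r addr0.
  by have := IH w; have := @lis_tailS _ w (c + r)%N (ltnW cr); lia.
have h1 := lis_tail_desc cr dw; have h2 := score_adj_le cr dw cj.
have h3 := IH w; have h4 := IH (adj m (c + r) * w)%g.
(* The truncated subtraction is exact, since [h3] and [h1] bound [score w c]. *)
pose k := ((t + r + lis_tail w (c + r).+1).+1 - score w c)%N.
have vk : (msize (sweep c x v r w) <= k)%N by rewrite /k; lia.
have uk : (msize (sweep c x v r (adj m (c + r) * w)%g) <= k)%N by rewrite /k; lia.
by have := msize_hecke r dw vk uk; rewrite /k; lia.
Qed.

Lemma score_last w : score w m = 1%N.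
Proof.
rewrite /score (bigD1 (pos m m)) ?inE ?val_pos //= big1.
  rewrite addn0; apply/eqP; rewrite eqn_leq ltn0Sn andbT -(lis_tail_last w).
  by rewrite lis_from_tail // val_pos.
move=> q; rewrite tailD1 // inE; have := ltn_ord q; lia.
Qed.

Lemma msize_kirillov d w : (d <= m)%N ->
  (msize (kirillov x d w) + score w (m - d) <= (triangle d).+1)%N.
Proof.
elim: d w => [|d IH] w dm.
  rewrite subn0 score_last /triangle big_ord1 addn1 ltnS /=.
  by case: (w == 1%g); rewrite ?msize1 ?msize0.
have cm : (m - d.+1 + d.+1 = m)%N by lia.
have vt u : (msize (kirillov x d u) + score u (m - d.+1).+1 <= (triangle d).+1)%N.
  by rewrite -subSn // subSS; apply: IH; lia.
(* At the end Lambda is 1; with the [d.+1] letters of the column this is the increment in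
   [triangleS]. *)
have := msize_sweep vt (r := d.+1) _ w; rewrite cm lis_tail_last triangleS.
by move=> /(_ (leqnn _)) /=; lia.
Qed.

End UpperBound.

(** * Lower bound through a specialization without cancellation *)

Section LowerBound.
Implicit Types v : 'S_m.+1 -> {poly int}.

(* At [x r = - 'X] the coefficient at [w] has sign [(-1) ^ length w], so that
   no cancellation occurs between the terms of [hecke]. *)
Definition unsign v w : {poly int} := (-1) ^+ (odd_perm w) * v w.

Lemma unsign_hecke j v w : (j < m)%N -> desc w j ->
  unsign (hecke j (- 'X) v) w =
  unsign v w + 'X * (unsign v w + unsign v (adj m j * w)%g).
Proof.
move=> jm dw; rewrite /unsign /hecke dw odd_permM odd_tperm pos_eq; try lia.
have -> : (j != j.+1) by lia.
by case: (odd_perm w); rewrite /= ?expr0 ?expr1; ring.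
Qed.

Lemma unsign_hecke0 j v w : ~~ desc w j -> unsign (hecke j (- 'X) v) w = unsign v w.
Proof. by move=> ndw; rewrite /unsign /hecke (negPf ndw) mulr0 mul0r addr0. Qed.

Definition nonneg v := forall w e, 0 <= (unsign v w)`_e.

Lemma nonneg_hecke j v : (j < m)%N -> nonneg v -> nonneg (hecke j (- 'X) v).
Proof.
move=> jm v0 w e; have [dw|ndw] := boolP (desc w j); last by rewrite unsign_hecke0.
rewrite unsign_hecke // coefD coefXM coefD addr_ge0 //.
by case: ifP => // _; rewrite addr_ge0.
Qed.

Lemma nonneg_sweep c v r : (c + r <= m)%N -> nonneg v ->
  nonneg (sweep c (fun=> - 'X) v r).
Proof.
move=> + v0; elim: r => //= r IH cr.
by apply: nonneg_hecke; [lia | apply: IH; lia].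
Qed.

Lemma nonneg_kirillov d : (d <= m)%N -> nonneg (kirillov (fun=> - 'X) d).
Proof.
elim: d => [|d IH] dm; last by apply: nonneg_sweep; [lia | apply: IH; lia].
move=> w e; rewrite /unsign /=; case: eqP => [->|_]; last by rewrite mulr0 coef0.
by rewrite odd_perm1 expr0 mul1r coef1; case: (e == _).
Qed.

(** The columns from [c] on only use letters at least [c], so only such permutations can have a
    nonzero coefficient there. *)
Definition fixes_below c w := forall p, (p < c)%N -> w p = p.

Lemma fixes_below_min c w p : fixes_below c w -> (c <= p)%N -> (c <= w p)%N.
Proof.
move=> fw cp; rewrite leqNgt; apply/negP => wpc.
by have := fw _ wpc => /perm_inj E; move: wpc; rewrite E; lia.
Qed.

Lemma fixes_below_adj c j w : (c <= j)%N -> (j < m)%N -> fixes_below c w ->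
  fixes_below c (adj m j * w)%g.
Proof.
move=> cj jm fw p pc; rewrite permM tpermD ?fw // -val_eqE /= val_pos; lia.
Qed.

Lemma lower_sweep c v t : nonneg v ->
    (forall w, fixes_below c.+1 w ->
       exists e, 0 < (unsign v w)`_e /\ (t <= e + score w c.+1)%N) ->
  forall r, (c + r <= m)%N -> forall w, fixes_below c w ->
    (lis_tail w (c + r) <= lis_from w (pos m (c + r)))%N ->
    (forall p, (c + r < p)%N -> w p != c :> nat) ->
  exists e, 0 < (unsign (sweep c (fun=> - 'X) v r) w)`_e /\
            (t + r + lis_tail w (c + r) <= e + score w c)%N.
Proof.
move=> v0 vt; elim=> [|r IH] cr w fw peak wc /=.
  rewrite !addn0 in cr peak wc *.
  (* The value [c] sits at a position at most [c], and smaller positions are fixed, so the bound for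
     the previous columns applies to [w]. *)
  have wcc : w (pos m c) = pos m c.
    pose p := (w^-1)%g (pos m c); have wp : w p = pos m c by rewrite permKV.
    have : (p <= c)%N by rewrite leqNgt; apply/negP => /wc; rewrite wp val_pos ?eqxx.
    rewrite leq_eqVlt => /orP[/eqP pc|/[dup] pc /fw].
      by rewrite -[RHS]wp; congr (w _); apply/val_inj; rewrite /= val_pos.
    by rewrite wp => E; move: pc; rewrite -E val_pos // ltnn.
  have [|e [e0 te]] := vt w.
    move=> p; rewrite ltnS leq_eqVlt => /orP[/eqP pc|/fw//].
    by have -> : p = pos m c by apply/val_inj; rewrite /= val_pos.
  by exists e; split=> //; rewrite (@score_pos _ w c) //; lia.
rewrite addnS in cr peak wc *; set j := (c + r)%N in IH cr peak wc *.
have cj : (c <= j)%N by rewrite leq_addr.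
have {}IH := IH (ltnW cr).
set S := sweep c _ v r in IH *.
have S0 : nonneg S by apply: nonneg_sweep => //; lia.
have [va vb] := ab_val cr.
have wcj : (lis_tail w j <= lis_from w (pos m j))%N -> w (pos m j.+1) != c :> nat ->
  exists e, 0 < (unsign S w)`_e /\ (t + r + lis_tail w j <= e + score w c)%N.
  move=> pk wb; apply: IH => // p; rewrite leq_eqVlt => /orP[/eqP jp|/wc //].
  by have -> : p = pos m j.+1 by apply/val_inj; rewrite /= vb.
have [dw|ndw] := boolP (desc w j); last first.
  have wab : (w (pos m j) < w (pos m j.+1))%N.
    move: ndw; rewrite /desc -leqNgt leq_eqVlt => /orP[/eqP/val_inj/perm_inj/eqP|//].
    by rewrite pos_eq; lia.
  rewrite unsign_hecke0 //.
  (* At an ascent [a] prolongs a longest set from [b], so the peak moves to [a]. *)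
  have up : (lis_from w (pos m j.+1) < lis_from w (pos m j))%N.
    have [I [Iw bI Ib <-]] := lis_from_ex w (pos m j.+1).
    have aI : pos m j \notin I by apply/negP => /Ib; rewrite va vb ltnn.
    have <- : #|pos m j |: I| = #|I|.+1 by rewrite cardsU1 aI.
    have Ij q : q \in I -> (j < q)%N by move/Ib; rewrite vb.
    apply: lis_from_ge; rewrite ?setU11 //; last first.
      by move=> q; rewrite !inE => /predU1P[->//|/Ij]; rewrite va; lia.
    apply/incP => p q; rewrite !inE => /predU1P[->|pI] /predU1P[->|qI].
    - by rewrite ltnn.
    - move=> _; apply: leq_trans wab _.
      have := Ib q qI; rewrite leq_eqVlt => /orP[/eqP/val_inj->//|bq].
      by rewrite ltnW // (incP _ _ Iw).
    - by rewrite va => pj; have := Ij p pI; lia.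
    - exact: (incP _ _ Iw).
  have tS := @lis_tailS _ w j (ltnW cr).
  have [||e [e0 te]] := wcj; first lia.
    have := @fixes_below_min c w (pos m j) fw; rewrite va => /(_ cj); lia.
  have := @lis_from_tail _ w (pos m j) j; rewrite va => /(_ (leqnn _)) fj.
  exists e; split=> //; move: te fj up peak; lia.
rewrite unsign_hecke //.
(* Keep the term at [w] if both conditions persist at [j]; otherwise pass to [u], and either failure
   supplies a hypothesis of [score_adj_ge]. *)
have [/andP[wb hi]|low] := boolP ((w (pos m j.+1) != c :> nat) &&
                               (lis_tail w j.+1 <= lis_from w (pos m j))%N).
  have td := lis_tail_desc cr dw.
  have [||e [e0 te]] := wcj => //; first exact: leq_trans td hi.
  exists e.+1; split.
    by rewrite coefD coefXM /= coefD ltr_wpDl // ltr_pwDl.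
  have := @lis_from_tail _ w (pos m j) j; rewrite va => /(_ (leqnn _)); lia.
set u := (adj m j * w)%g.
have := score_adj_ge cr dw peak cj; rewrite -/u => sc.
have [|||e [e0 te]] := IH u.
- exact: fixes_below_adj.
- exact: peak_adj.
- move=> p jp; have [->|pb] := eqVneq p (pos m j.+1).
    rewrite adj_posR; move: dw; rewrite /desc.
    have := @fixes_below_min c w (pos m j.+1) fw; rewrite vb; lia.
  rewrite adjE //; last by rewrite -val_eqE /= va; lia.
  apply: wc; rewrite ltn_neqAle jp andbT; apply: contra pb => /eqP E.
  by rewrite -val_eqE /= vb E.
exists e.+1; split; first by rewrite coefD coefXM /= coefD ltr_wpDl // ltr_wpDl.
suff : (score u c + lis_tail w j.+1 <= score w c + lis_tail u j)%N by lia.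
apply: sc; rewrite negb_and -ltnNge negbK in low.
case/orP: low => [/eqP wb|lt]; last by left.
by right=> p cp; rewrite wb; apply: fixes_below_min.
Qed.

Lemma lower_kirillov d w : (d <= m)%N -> fixes_below (m - d) w ->
  exists e, 0 < (unsign (kirillov (fun=> - 'X) d) w)`_e /\
            (triangle d <= e + score w (m - d))%N.
Proof.
elim: d w => [|d IH] w dm fw.
  exists 0; rewrite subn0 in fw *; rewrite score_last /triangle big_ord1; split=> //.
  rewrite /unsign /=; have -> : w = 1%g.
    apply/permP => p; rewrite perm1; have := ltn_ord p.
    rewrite ltnS leq_eqVlt => /orP[/eqP pm|/fw//].
    have := fixes_below_min fw (p := p); rewrite pm leqnn => /(_ isT) mwp.
    by apply/val_inj/eqP; rewrite /= eqn_leq pm mwp andbT -ltnS.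
  by rewrite eqxx odd_perm1 expr0 mul1r coef1.
set c := (m - d.+1)%N in fw *; have cm : (c + d.+1 = m)%N by rewrite /c; lia.
have vt u : fixes_below c.+1 u -> exists e,
    0 < (unsign (kirillov (fun=> - 'X) d) u)`_e /\ (triangle d <= e + score u c.+1)%N.
  by move: (IH u (ltnW dm)); have -> : (m - d = c.+1)%N by lia.
have [|||e [e0 te]] := @lower_sweep c _ _ (nonneg_kirillov (ltnW dm)) vt d.+1 _ w fw.
- by rewrite cm.
- by rewrite cm lis_tail_last.
- by move=> p; rewrite cm; have := ltn_ord p; lia.
exists e; split=> //; move: te; rewrite cm lis_tail_last triangleS; lia.
Qed.

End LowerBound.

End Degree.

(** * The coefficient of the longest permutation *)

Section LongestCoefficient.
Variable m : nat.
Implicit Types (w u : 'S_m.+1).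

Definition inversions w : {set 'I_m.+1 * 'I_m.+1} :=
  [set pq : 'I_m.+1 * 'I_m.+1 | (pq.1 < pq.2)%N && (w pq.2 < w pq.1)%N].

Lemma card_inversions_adj j w : (j < m)%N ->
  (#|inversions w| <= #|inversions (adj m j * w)%g|.+1)%N.
Proof.
move=> jm; have [va vb] := ab_val jm.
pose s2 (pq : 'I_m.+1 * 'I_m.+1) := (adj m j pq.1, adj m j pq.2).
have s2_inj : injective s2 by move=> [p q] [p' q'] [/perm_inj-> /perm_inj->].
rewrite (cardsD1 (pos m j, pos m j.+1)) -(card_imset _ s2_inj).
apply: leq_trans (leq_add (leq_b1 _) (leqnn _)) _; rewrite add1n ltnS.
apply/subset_leq_card/subsetP => _ /imsetP[[p q] + ->]; rewrite !inE /= => /and3P[ne pq wqp].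
rewrite !adjJ wqp andbT; case: (adj_lt jm pq) => // -[pa qb].
by rewrite pa qb eqxx in ne.
Qed.

Section Graded.
Variable R : comNzRingType.
Implicit Types (v : 'S_m.+1 -> R) (x : nat -> R).

(** Each factor adds at most one inversion, so reaching the maximum takes the letter of every cell.
    The value 0 is left open here; [kirillov_neq0] excludes it at the end. *)
Definition top_monomial N (M : R) v := forall w,
  ((N < #|inversions w|)%N -> v w = 0) /\
  (#|inversions w| = N -> v w = 0 \/ v w = M).

Lemma top_monomial_hecke N M j y v : (j < m)%N -> top_monomial N M v ->
  top_monomial N.+1 (y * M) (hecke j y v).
Proof.
move=> jm vM w; have := card_inversions_adj w jm; rewrite /hecke => le_inv.
have [v0 _] := vM w; have [u0 uM] := vM (adj m j * w)%g.
split=> [lt_inv|eq_inv].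
  rewrite v0 ?u0; [by rewrite subrr mulr0 addr0 | lia | lia].
rewrite v0 ?eq_inv // add0r subr0.
case: (desc w j); last by left; rewrite mulr0 mul0r.
rewrite mulr1; move: le_inv; rewrite eq_inv ltnS leq_eqVlt => /orP[/eqP/esym/uM|/u0->].
  by case=> ->; [left; rewrite mulr0 | right].
by left; rewrite mulr0.
Qed.

Lemma top_monomial_sweep N M c x v r : (c + r <= m)%N -> top_monomial N M v ->
  top_monomial (N + r) (\prod_(i < r) x i * M) (sweep c x v r).
Proof.
move=> + vM; elim: r => [|r IH] cr; first by rewrite big_ord0 mul1r addn0.
rewrite big_ord_recr /= addnS [_ * x r]mulrC -mulrA.
by apply: top_monomial_hecke; [lia | apply: IH; lia].
Qed.

Lemma top_monomial_kirillov x d : (d <= m)%N ->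
  top_monomial (\sum_(i < d) i.+1)%N (\prod_(i < d) \prod_(j < i.+1) x j) (kirillov x d).
Proof.
elim: d => [|d IH] dm; last first.
  rewrite big_ord_recr [X in top_monomial _ X]big_ord_recr [X in top_monomial _ X]mulrC.
  by apply: (@top_monomial_sweep _ _ (m - d.+1) x _ d.+1); [lia | apply: IH; lia].
rewrite !big_ord0 => w; split=> [|_] /=; last by case: eqP; [right | left].
rewrite card_gt0 => /set0Pn[[p q]]; rewrite inE /= => /andP[pq].
by case: eqP => // ->; rewrite !perm1; move: pq; case: ltngtP.
Qed.

Lemma prod_staircase x d :
  \prod_(i < d) \prod_(j < i.+1) x j = \prod_(i < d.+1) x i ^+ (d - i).
Proof.
elim: d => [|d IH]; first by rewrite big_ord0 big_ord1 expr0.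
rewrite big_ord_recr /= IH -big_split /= [RHS]big_ord_recr /= subnn expr0 mulr1.
by apply: eq_bigr => i _; rewrite -exprSr subSn // -ltnS.
Qed.

End Graded.

Lemma card_lt_pairs :
  #|[set pq : 'I_m.+1 * 'I_m.+1 | (pq.1 < pq.2)%N]| = (\sum_(i < m) i.+1)%N.
Proof.
rewrite -sum1_card (eq_bigl (fun pq : 'I_m.+1 * 'I_m.+1 => pq.1 < pq.2)%N); last first.
  by move=> pq; rewrite inE.
rewrite -(pair_big_dep xpredT (fun p q : 'I_m.+1 => p < q)%N (fun _ _ => 1)%N) /=.
rewrite (exchange_big_dep xpredT) //= big_ord_recl big_pred0 ?add0n; last by move=> p; rewrite ltn0.
apply: eq_bigr => i _; rewrite -(big_ord_widen _ (fun _ => 1%N)); last exact: ltnW.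
by rewrite sum1_card card_ord.
Qed.

Lemma card_inversions_longest : #|inversions (longest m.+1)| = (\sum_(i < m) i.+1)%N.
Proof.
rewrite -card_lt_pairs; congr #|pred_of_set _|; apply/setP => -[p q]; rewrite !inE !permE /=.
by have := ltn_ord p; have := ltn_ord q; lia.
Qed.

End LongestCoefficient.

(** * Grothendieck polynomials as coefficients, and their degree *)

Section Grothendieck.
Variable m : nat.
Implicit Types (w u : 'S_m.+1).

Definition var r : {mpoly int[m.+1]} := 'X_(pos m r).

(** Specialization cannot raise the degree, so the coefficients found by [lower_kirillov] bound
    [msize] from below. *)
Lemma size_mmap_oppX (f : {mpoly int[m.+1]}) :
  (size (mmap polyC (fun=> - 'X : {poly int}) f) <= msize f)%N.
Proof.
apply: leq_trans (size_sum _ _ _) _; apply/bigmax_leqP_seq => k kf _.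
apply: leq_trans (msize_mdeg_lt kf).
rewrite mul_polyC; apply: leq_trans (size_scale_leq _ _) _.
rewrite /mmap1 prodrXr -mdegE.
by rewrite exprNn -signr_odd; case: (odd _);
  rewrite ?expr0 ?expr1 ?mul1r ?mulN1r ?size_polyN size_polyXn.
Qed.

Lemma mmap_kirillov w :
  mmap polyC (fun=> - 'X) (kirillov var m w) = kirillov (fun=> - 'X : {poly int}) m w.
Proof.
rewrite (rmorph_kirillov (mmap polyC (fun=> - 'X))).
by apply: kirillov_ext => r; rewrite /= mmapX mmap1U.
Qed.

Lemma kirillov_neq0 w : kirillov var m w != 0.
Proof.
have [|e [e0 _]] := @lower_kirillov m m w (leqnn m); first by rewrite subnn => p.
apply: contraTneq e0 => K0; rewrite /unsign -mmap_kirillov K0 mmap0.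
by rewrite mulr0 coef0 Order.POrderTheory.ltxx.
Qed.

Lemma msize_kirillov_eq w :
  (msize (kirillov var m w) + score w 0 = (triangle m).+1)%N.
Proof.
apply/eqP; rewrite eqn_leq; apply/andP; split.
  have -> : 0%N = (m - m)%N by rewrite subnn.
  by apply: msize_kirillov => // r; rewrite msizeX mdeg1.
have [|e [e0 te]] := @lower_kirillov m m w (leqnn m); first by rewrite subnn => p.
rewrite subnn in te; apply: leq_ltn_trans te _; rewrite -addSn leq_add2r.
apply: leq_trans (size_mmap_oppX _); rewrite mmap_kirillov ltnNge; apply/negP => le.
move: e0; rewrite /unsign -signr_odd; case: (odd _);
  by rewrite ?expr0 ?expr1 ?mul1r ?mulN1r ?coefN nth_default // ?oppr0 Order.POrderTheory.ltxx.
Qed.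

Lemma kirillov_longest :
  kirillov var m (longest m.+1) = \prod_(i < m.+1) 'X_i ^+ (m.+1 - i.+1).
Proof.
have [_ /(_ (card_inversions_longest m))] :=
  top_monomial_kirillov var (leqnn m) (longest m.+1).
rewrite prod_staircase => -[E|->].
  by have := kirillov_neq0 (longest m.+1); rewrite E eqxx.
by apply: eq_bigr => i _; rewrite /var /pos inord_val subSS.
Qed.

(** With [phi] the exchange of the two variables, [kirillov_step] is the equation defining
    [isobaric], once ['X_i - 'X_j] is cancelled. *)
Lemma grothendieck_kirillov w G : grothendieck w G -> G = kirillov var m w.
Proof.
elim=> [|{}w i j {}G ij wji _ ->]; first exact/esym/kirillov_longest.
have im : (i < m)%N by have := ltn_ord j; lia.
have pi : pos m i = i by rewrite /pos inord_val.
have pj : pos m i.+1 = j by rewrite /pos -ij inord_val.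
have dw : desc w i by rewrite /desc pi pj.
have neij : i != j by rewrite -val_eqE /= ij; lia.
have XB0 k : 1 - 'X_k != 0 :> {mpoly int[m.+1]}.
  apply/eqP => /(congr1 (mcoeff 0%MM)); rewrite mcoeffB mcoeff1 mcoeffX mcoeff0 eqxx.
  by rewrite mnm1_eq0.
have sX k : msym (tperm i j) 'X_k = 'X_(tperm i j k) :> {mpoly int[m.+1]}.
  by rewrite /msym mmapX mmap1U.
have neX : 'X_i - 'X_j != 0 :> {mpoly int[m.+1]}.
  rewrite subr_eq0; apply/eqP => /(congr1 (mcoeff U_(i)%MM)).
  by rewrite !mcoeffXU eqxx eq_sym (negPf neij).
apply: (mulfI neX); rewrite /isobaric divdiffE.
have := @kirillov_step m _ (msym (tperm i j)) var i; rewrite /var pi pj.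
rewrite /adj pi pj => step; rewrite step //.
- by have := sX i; rewrite tpermL.
- by have := sX j; rewrite tpermR.
move=> r rm ri rj; have := sX (pos m r); rewrite tpermD //.
  by rewrite -pi pos_eq; lia.
by rewrite -pj pos_eq; lia.
Qed.

Lemma mpdeg_grothendieck w G : grothendieck w G ->
  (mpdeg G + score w 0 = triangle m)%N.
Proof.
move/grothendieck_kirillov ->; have := msize_kirillov_eq w; rewrite /mpdeg.
have : (0 < msize (kirillov var m w))%N.
  by rewrite lt0n; apply: contra (kirillov_neq0 w); rewrite msize_poly_eq0.
by case: (msize _) => // k _ [].
Qed.

End Grothendieck.

(** * 1432-avoiding permutations *)

Section DiagonalPaths.
Variable n : nat.
Implicit Types (A : {set 'I_n * 'I_n}) (s : seq ('I_n * 'I_n)).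

Lemma cell_lt_trans : transitive (@cell_lt n).
Proof. by move=> b a c /andP[h1 h2] /andP[h3 h4]; apply/andP; split; lia. Qed.

Lemma sorted_cell_uniq s : sorted (@cell_lt n) s -> uniq s.
Proof. by apply: sorted_uniq => [|a]; [apply: cell_lt_trans | rewrite /cell_lt /= ltnn]. Qed.

Lemma rho_d_ge A s : sorted (@cell_lt n) s -> {subset s <= A} -> (size s <= rho_d A)%N.
Proof.
move=> ss sA; have us := sorted_cell_uniq ss.
have cs : size s = #|[set:: s]| by rewrite cardsE (card_uniqP us).
rewrite cs /rho_d (bigD1 [set:: s]) /=; first exact: leq_maxl.
apply/andP; split; first by apply/subsetP => c; rewrite inE => /sA.
by apply/existsP; exists (tcast cs (in_tuple s)); rewrite val_tcast ss eqxx.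
Qed.

Lemma rho_d_le A k : (forall s, sorted (@cell_lt n) s -> {subset s <= A} -> (size s <= k)%N) ->
  (rho_d A <= k)%N.
Proof.
move=> H; apply/bigmax_leqP => P /andP[/subsetP PA /existsP[t /andP[st /eqP Pt]]].
rewrite -{1}(size_tuple t); apply: H => // c ct; apply: PA.
by rewrite Pt inE.
Qed.

Variable w : 'S_n.
Implicit Types (U I J : {set 'I_n}) (i j k p q : 'I_n).

Definition avoids321 U := forall i j k, i \in U -> j \in U -> k \in U ->
  (i < j)%N -> (j < k)%N -> ~~ ((w k < w j)%N && (w j < w i)%N).

(* The cells of the Rothe diagram are the inversions: [(i, w q)] stands for the
   inversion at positions [i < q]. *)
Definition cells_on U : {set 'I_n * 'I_n} :=
  [set c in rothe w | (c.1 \in U) && ((w^-1)%g c.2 \in U)].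

Lemma cells_onP U i q : ((i, w q) \in cells_on U) =
  [&& (i < q)%N, (w q < w i)%N, i \in U & q \in U].
Proof. by rewrite !inE /= permK [X in X && _]andbC -andbA. Qed.

(** Each inversion of the path has an end outside [I], selected by [f]. Along a path these ends are
    distinct: a bottom that is also a top would give a 321 pattern. *)
Lemma inc_path_le U I s : avoids321 U -> I \subset U -> inc w I ->
  sorted (@cell_lt n) s -> {subset s <= cells_on U} -> (#|I| + size s <= #|U|)%N.
Proof.
move=> U321 IU Iw ss sU.
pose f (c : 'I_n * 'I_n) := if c.1 \in I then (w^-1)%g c.2 else c.1.
rewrite -(cardsID I U) (setIidPr IU) leq_add2l -(size_map f s).
have fs : uniq (map f s).
  rewrite uniq_pairwise pairwise_map.
  apply: (@sub_in_pairwise _ (mem (cells_on U)) (@cell_lt n)); last 2 first.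
  - by apply/allP.
  - by rewrite -(sorted_pairwise cell_lt_trans).
  move=> [i x] [j y] ix jy.
  move: (ix : (i, x) \in cells_on U) (jy : (j, y) \in cells_on U) => {ix jy}.
  rewrite -(permKV w x) -(permKV w y).
  move: ((w^-1)%g x) ((w^-1)%g y) => p q; rewrite !cells_onP /f /= !permK.
  move=> /and4P[ip wpi iU pU] /and4P[jq wqj jU qU] /andP[/= ij wpq].
  case: ifP => iI; case: ifP => jI.
  - by apply: contraTneq wpq => ->; rewrite ltnn.
  - apply: contraT; rewrite negbK => /eqP pj; subst j.
    by have := U321 i p q iU jU qU ip jq; rewrite wpi wqj.
  - apply: contraT; rewrite negbK => /eqP iq; subst q.
    by have := U321 j i p jU iU pU jq ip; rewrite wpi wqj.
  - by apply: contraTneq ij => ->; rewrite ltnn.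
rewrite -(card_uniqP fs); apply/subset_leq_card/subsetP => p /mapP[[i x] + ->].
rewrite -(permKV w x); move: ((w^-1)%g x) => q /sU; rewrite cells_onP /f /= permK inE.
move=> /and4P[iq wqi iU qU]; case: ifP => iI; last by rewrite iI iU.
rewrite qU andbT; apply/negP => qI.
by have := incP _ _ Iw i q iI qI iq; lia.
Qed.

(* The first top [i] and the first bottom [q] of an inversion form an inversion
   themselves, and an increasing set avoiding both can be enlarged by one of
   them. *)
Lemma inc_path_ex U : avoids321 U -> exists I s,
  [/\ I \subset U, inc w I, sorted (@cell_lt n) s, {subset s <= cells_on U} &
      (#|U| <= #|I| + size s)%N].
Proof.
have [N] := ubnP #|U|; elim: N U => // N IH U; rewrite ltnS => leUN U321.
have [Uw|nUw] := boolP (inc w U).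
  by exists U, [::]; rewrite addn0; split.
pose inv i q := [&& (i < q)%N, (w q < w i)%N, i \in U & q \in U].
have inv_of i q : i \in U -> q \in U -> (i < q)%N -> ~~ (w i < w q)%N -> inv i q.
  move=> iU qU iq wiq; rewrite /inv iq iU qU !andbT ltn_neqAle leqNgt wiq andbT.
  by apply: contraTneq iq => /val_inj/perm_inj ->; rewrite ltnn.
have [i1 [q1 iq1]] : exists i q, inv i q.
  case/forall_inPn: nUw => i iU /forall_inPn[q qU]; rewrite negb_imply => /andP[iq wiq].
  by exists i, q; apply: inv_of.
pose top i := [exists q, inv i q]; pose bot q := [exists i, inv i q].
have topI i q : inv i q -> top i by move=> h; apply/existsP; exists q.
have botI i q : inv i q -> bot q by move=> h; apply/existsP; exists i.
case: (@arg_minnP _ i1 top (fun i => i) (topI _ _ iq1)) => i /existsP[q' iq'] imin.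
case: (@arg_minnP _ q1 bot (fun i => i) (botI _ _ iq1)) => q /existsP[i' iq''] qmin.
have no321 a b c : inv a b -> inv b c -> False.
  move=> /and4P[ab wba aU bU] /and4P[bc wcb _ cU].
  by have := U321 a b c aU bU cU ab bc; rewrite wba wcb.
(* If [w q' < w q] with [q < q'], then [i'], [q], [q'] would form a 321 pattern; hence
   [w q <= w q' < w i]. *)
have iq : inv i q.
  have ii' := imin _ (topI _ _ iq''); have qq' := qmin _ (botI _ _ iq').
  have /and4P[h1 h2 h3 h4] := iq'; have /and4P[h5 h6 h7 h8] := iq''.
  apply/and4P; split=> //; first exact: leq_ltn_trans ii' h5.
  move: qq'; rewrite leq_eqVlt => /orP[/eqP/val_inj->//|qq'].
  apply: ltn_trans h2; apply: contraT => wqq'.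
  by case: (no321 _ _ _ iq'' (inv_of _ _ h8 h4 qq' wqq')).
have /and4P[liq wqi iU qU] := iq.
have neiq : i != q by apply: contraTneq liq => ->; rewrite ltnn.
pose V := U :\ i :\ q.
have VU : V \subset U by apply: subset_trans (subsetDl _ _) (subsetDl _ _).
have VP p : p \in V -> [/\ p \in U, p != i & p != q].
  by rewrite !inE => /and3P[].
have cUV : #|U| = #|V|.+2.
  by rewrite (cardsD1 i) iU (cardsD1 q (U :\ i)) !inE eq_sym neiq qU.
have [I [s [IV Iw ss sV cV]]] : exists I s,
    [/\ I \subset V, inc w I, sorted (@cell_lt n) s, {subset s <= cells_on V} &
      (#|V| <= #|I| + size s)%N].
  apply: IH; first by apply: leq_trans leUN; rewrite cUV.
  by move=> a b c /(subsetP VU) aU /(subsetP VU) bU /(subsetP VU); apply: U321.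
have IU p : p \in I -> [/\ p \in U, p != i & p != q] by move/(subsetP IV)/VP.
have top_lt a b : inv a b -> a != i -> (i < a)%N.
  by move=> ab ai; rewrite ltn_neqAle imin ?(topI _ _ ab) // andbT eq_sym.
have bot_lt a b : inv a b -> b != q -> (q < b)%N.
  by move=> ab ai; rewrite ltn_neqAle qmin ?(botI _ _ ab) // andbT eq_sym.
suff [J [JU Jw cJ]] : exists J, [/\ J \subset U, inc w J & #|J| = #|I|.+1].
  exists J, ((i, w q) :: s); split=> //.
  (* Any inversion [(a, b)] within [V] has [i < a] and [w q < w b], so the cell of [(i, q)] can
     start the path. *)
  - rewrite /= path_min_sorted //; apply/allP => -[a x] /sV.
    rewrite -(permKV w x); move: ((w^-1)%g x) => b; rewrite cells_onP.
    move=> /and4P[ab wba /VP[aU ai _] /VP[bU _ bq]].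
    have iab : inv a b by apply/and4P.
    rewrite /cell_lt /= (top_lt _ _ iab ai); apply: contraT => wqb.
    by case: (no321 _ _ _ iq (inv_of _ _ qU bU (bot_lt _ _ iab bq) wqb)).
  - move=> [a x]; rewrite inE => /predU1P[->|/sV]; first by rewrite cells_onP.
    rewrite -(permKV w x); move: ((w^-1)%g x) => b; rewrite !cells_onP.
    by move=> /and4P[-> -> /VP[-> _ _] /VP[-> _ _]].
  - by rewrite cUV /= cJ addSn addnS !ltnS.
have [/forall_inP hi|/forall_inPn[b bI]] :=
  boolP [forall b in I, (i < b)%N ==> (w i < w b)%N].
  exists (i |: I); split.
  - by apply/subsetP => p; rewrite !inE => /predU1P[->|/IU[]].
  - apply/incP => a b; rewrite !inE => /predU1P[->|aI] /predU1P[->|bI].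
    + by rewrite ltnn.
    + by apply/implyP/hi.
    + move=> ai; have [aU nai _] := IU _ aI; apply: contraT => wai.
      by have := ltn_trans ai (top_lt _ _ (inv_of _ _ aU iU ai wai) nai); rewrite ltnn.
    + exact: (incP _ _ Iw).
  - by rewrite cardsU1; case: (boolP (i \in I)) => // /IU[_]; rewrite eqxx.
rewrite negb_imply => /andP[ib wib].
have [/forall_inP hq|/forall_inPn[a aI]] :=
  boolP [forall a in I, (a < q)%N ==> (w a < w q)%N].
  exists (q |: I); split.
  - by apply/subsetP => p; rewrite !inE => /predU1P[->|/IU[]].
  - apply/incP => a c; rewrite !inE => /predU1P[->|aI] /predU1P[->|cI].
    + by rewrite ltnn.
    + move=> qc; have [cU _ _] := IU _ cI; apply: contraT => wqc.
      by case: (no321 _ _ _ iq (inv_of _ _ qU cU qc wqc)).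
    + by apply/implyP/hq.
    + exact: (incP _ _ Iw).
  - by rewrite cardsU1; case: (boolP (q \in I)) => // /IU[_ _]; rewrite eqxx.
(* If neither [i] nor [q] can be added, then [a < q < b] and [w i < w a < w b < w i], a
   contradiction. *)
rewrite negb_imply => /andP[aq waq].
have [aU ai naq] := IU _ aI; have [bU bi bq] := IU _ bI.
have iaq := inv_of _ _ aU qU aq waq; have iib := inv_of _ _ iU bU ib wib.
have ia := top_lt _ _ iaq ai; have qb := bot_lt _ _ iib bq.
have /and4P[_ wib' _ _] := iib.
have wia : (w i < w a)%N.
  by apply: contraT => wia; case: (no321 _ _ _ (inv_of _ _ iU aU ia wia) iaq).
have wab := incP _ _ Iw a b aI bI (ltn_trans aq qb).
by have := ltn_trans (ltn_trans wia wab) wib'; rewrite ltnn.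
Qed.

Lemma card_avoids321 U : avoids321 U -> #|U| = (lis w U + rho_d (cells_on U))%N.
Proof.
move=> U321; apply/eqP; rewrite eqn_leq; apply/andP; split.
  have [I [s [IU Iw ss sU]]] := inc_path_ex U321; move/leq_trans; apply.
  by apply: leq_add; [apply: lis_ge | apply: rho_d_ge].
have [I [IU Iw <-]] := lis_ex w U.
rewrite -leq_subRL ?subset_leq_card //; apply: rho_d_le => s ss sU.
by rewrite leq_subRL ?subset_leq_card //; apply: inc_path_le.
Qed.

(** [sigma] bounds the top position and the bottom value of an inversion; the inversion passes these
    bounds on to its other position and value. *)
Lemma sigma_cells_on k : sigma w k = cells_on (above w k).
Proof.
apply/setP => -[i x]; rewrite -(permKV w x); move: ((w^-1)%g x) => q.
rewrite cells_onP !inE /= permK.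
by case: ltngtP; case: ltngtP => //= *; lia.
Qed.

Lemma avoids1432_above k : avoids1432 w -> avoids321 (above w k).
Proof.
move=> w1432 a b c; rewrite !inE => /andP[ka wka] /andP[kb wkb] /andP[kc wkc] ab bc.
apply/negP => /andP[wcb wba]; apply: w1432; exists k, a, b, c.
by split; split.
Qed.

End DiagonalPaths.

(** * Counting inversions and the degree formula *)

Lemma card_rothe m (w : 'S_m.+1) : #|rothe w| = #|inversions w|.
Proof.
pose f (pq : 'I_m.+1 * 'I_m.+1) := (pq.1, w pq.2).
have f_inj : injective f by move=> [a b] [c d] [-> /perm_inj ->].
rewrite -(card_imset (mem (inversions w)) f_inj); apply: eq_card => -[i x].
rewrite -(permKV w x); move: ((w^-1)%g x) => q.
rewrite -[(i, w q)]/(f (i, q)) mem_imset // !inE /= permK andbC //.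
Qed.

(** A pair [p < q] is either an inversion or puts [q] in [above w p]. *)
Lemma card_rothe_above m (w : 'S_m.+1) :
  (#|rothe w| + \sum_(p < m.+1) #|above w p| = \sum_(i < m) i.+1)%N.
Proof.
rewrite -card_lt_pairs card_rothe; set P := [set pq | _].
rewrite -(cardsID (inversions w) P); congr addn.
  by apply: eq_card => pq; rewrite !inE andbA andbb.
rewrite /above; under eq_bigr do rewrite -sum1dep_card.
rewrite pair_big_dep /= sum1dep_card.
apply: eq_card => -[p q]; rewrite !inE /=.
case: (ltngtP (w q) (w p)) => [_|_|/val_inj/perm_inj->]; rewrite ?andbT ?andbF //=.
- by case: (p < q)%N.
- by rewrite ltnn.
Qed.

Theorem theorem1p3 (n : nat) (w : 'S_n) (G : {mpoly int[n]}) :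
  avoids1432 w -> grothendieck w G ->
  mpdeg G = (#|rothe w| + \sum_(k < n) rho_d (sigma w k))%N.
Proof.
case: n w G => [|m] w G w1432 wG.
  (* For [n = 0] the polynomial is the empty product 1, of degree 0. *)
  rewrite big_ord0 addn0 eq_card0; last by case=> -[].
  by case: wG => [|u []//]; rewrite big_ord0 /mpdeg msize1.
have degG := mpdeg_grothendieck wG; have cw := card_rothe_above w.
have scoreE : score w 0 = (m.+1 + \sum_(p < m.+1) lis w (above w p))%N.
  rewrite -[X in (X + _)%N]card_ord -sum1_card -big_split /=.
  by apply: eq_big => p; rewrite ?inE.
have aboveE : (\sum_(p < m.+1) #|above w p| =
    \sum_(p < m.+1) lis w (above w p) + \sum_(k < m.+1) rho_d (sigma w k))%N.
  rewrite -big_split /=; apply: eq_bigr => p _.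
  by rewrite sigma_cells_on; apply/card_avoids321/avoids1432_above.
have triangleE : triangle m = (\sum_(i < m) i.+1 + m.+1)%N.
  by rewrite /triangle big_ord_recr.
by move: degG; rewrite scoreE triangleE -cw aboveE; lia.
Qed.
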